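(* Let $I \subset \mathbb{R}$ be an interval and let $x_0$ be a point of the interior of $I$. The family of all quasi-arithmetic means $A^{[f]}$ generated by continuous, strictly monotone functions $f \colon I \to \mathbb{R}$ that are differentiable at $x_0$ is an interval-type set in the family of all quasi-arithmetic means on $I$.
   Context: For an interval $I\subset\mathbb{R}$ and a continuous, strictly monotone function $f \colon I \to \mathbb{R}$, the quasi-arithmetic mean generated by $f$ is the function $A^{[f]} \colon \bigcup_{n=1}^\infty I^n \to I$, $A^{[f]}(a_1,\dots,a_n) := f^{-1}\left(\frac{f(a_1)+\cdots+f(a_n)}{n}\right)$. For two such functions $f,g$ on the same interval $I$, $A^{[f]} \le A^{[g]}$ means $A^{[f]}(a) \le A^{[g]}(a)$ for all $a \in \bigcup_{n=1}^\infty I^n$. A set $\mathcal{I}$ of quasi-arithmetic means on $I$ is called an interval-type set (or interval) if, whenever $A^{[f]}, A^{[g]} \in \mathcal{I}$ and $A^{[h]}$ is a quasi-arithmetic mean on $I$ with $A^{[f]} \le A^{[h]} \le A^{[g]}$, then $A^{[h]} \in \mathcal{I}$. Differentiability at $x_0$ means that the (finite) derivative exists; it is allowed to be zero. *)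

(* Defs.v *)
(* MathComp-Analysis *)
From HB Require Import structures.
From mathcomp Require Import all_boot all_order all_algebra.
From mathcomp Require Import all_classical all_reals all_analysis.
Set Implicit Arguments.
Unset Strict Implicit.
Unset Printing Implicit Defensive.
Import Order.TTheory GRing.Theory Num.Theory.
Import numFieldNormedType.Exports.
Local Open Scope classical_set_scope.
Local Open Scope ring_scope.

(* Elements of the subtype of I are the reals lying in I; an n.+1.-tuple over
   that subtype is a point of I^(n+1), so only nonempty tuples occur. *)
Definition mean_type (R : realType) (I : set R) : Type :=
  forall n : nat, n.+1.-tuple I -> I.

(* A function I -> R is given by a function on the whole of R, of which only
   the restriction to I is constrained. *)
Definition generator (R : realType) (I : set R) (f : R -> R) : Prop :=
  {within I, continuous f} /\
  ({in I &, {homo f : x y / x < y}} \/ {in I &, {homo f : x y /~ x < y}}).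

(* A^[f]: the point y of I with f y = (f a_1 + ... + f a_(n+1)) / (n+1). For a
   generator f on an interval I this y exists and is unique (f @` I is an
   interval), so the default value of xget is then never used. *)
Definition qamean (R : realType) (I : set R) (f : R -> R) : mean_type I :=
  fun n a =>
    xget (thead a)
      [set y : I | f (val y) = (\sum_(i < n.+1) f (val (tnth a i))) / n.+1%:R].

Arguments qamean {R} I f n a.

Definition qameans (R : realType) (I : set R) : set (mean_type I) :=
  [set qamean I f | f in generator I].

Arguments qameans {R} I _.

Definition mean_le (R : realType) (I : set R) (M N : mean_type I) : Prop :=
  forall (n : nat) (a : n.+1.-tuple I), val (M n a) <= val (N n a).

Definition interval_type (R : realType) (I : set R) (S : set (mean_type I))
    : Prop :=
  S `<=` qameans I /\
  forall F G H : mean_type I,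
    S F -> S G -> qameans I H -> mean_le F H -> mean_le H G -> S H.

(* Main.v *)
(* For increasing generators, A^[f] <= A^[h] says that h is a convex function
   of f, so at x0 the graph of h has a supporting line in the variable f:
   h - h x0 >= P (f - f x0). Likewise g - g x0 >= Q (h - h x0) with Q > 0.
   Hence h lies between x |-> h x0 + P (f x - f x0) and
   x |-> h x0 + (g x - g x0) / Q, which are differentiable at x0 and touch
   there, so that h is differentiable at x0. *)
Require Import Defs.
From HB Require Import structures.
From mathcomp Require Import all_boot all_order all_algebra.
From mathcomp Require Import all_classical all_reals all_analysis.
From mathcomp Require Import ring lra.
Import Order.TTheory GRing.Theory Num.Theory.
Import numFieldNormedType.Exports.
Local Open Scope classical_set_scope.
Local Open Scope ring_scope.

(** * Differentiability of a squeezed function *)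

Lemma near_dnbhs0_shift (R : numFieldType) (c : R) (P : set R) :
  (\forall x \near c, P x) -> \forall t \near 0^', P (t *: 1 + c).
Proof.
move=> /nbhs0P cP; apply: nbhs_dnbhs; apply: filterS cP => t.
by rewrite /GRing.scale/= mulr1 addrC.
Qed.

(** Difference quotients are nonpositive to the left of [c] and nonnegative to the right; both
    one-sided limits equal the derivative. *)
Lemma derive_at_local_min (R : realFieldType) (w : R -> R) (c : R) :
  derivable w c 1 -> (\forall x \near c, w c <= w x) -> 'D_1 w c = 0.
Proof.
move=> dw /near_dnbhs0_shift wmin.
pose q t := t^-1 *: ((w \o shift c) (t *: 1) - w c).
have cq : q t @[t --> 0^'] --> 'D_1 w c by exact: dw.
apply/eqP; rewrite eq_le; apply/andP; split.
- apply: (ler_cvg_to (cvg_dnbhs_at_left cq) (cvg_cst (0 : R))).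
  move: wmin; rewrite !near_withinE => wmin.
  apply: filterS wmin => t wt t0; rewrite /q /=.
  have {}wt : w c <= w (t *: 1 + c) by apply: wt; rewrite lt_eqF.
  by rewrite mulr_le0_ge0 ?invr_le0 ?(ltW t0) ?subr_ge0.
- apply: (ler_cvg_to (cvg_cst (0 : R)) (cvg_dnbhs_at_right cq)).
  move: wmin; rewrite !near_withinE => wmin.
  apply: filterS wmin => t wt t0; rewrite /q /=.
  have {}wt : w c <= w (t *: 1 + c) by apply: wt; rewrite gt_eqF.
  by rewrite mulr_ge0 ?invr_ge0 ?(ltW t0) ?subr_ge0.
Qed.

(** Since [v - u] has a local minimum at [c], its derivative there is 0. Its difference quotients
    dominate those of [h - u] in absolute value, so the latter tend to 0 as well. *)
Lemma derivable_sandwich (R : realFieldType) (u h v : R -> R) (c : R) :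
  derivable u c 1 -> derivable v c 1 ->
  u c = h c -> v c = h c -> (\forall x \near c, u x <= h x <= v x) ->
  derivable h c 1.
Proof.
move=> du dv uc vc uhv.
have dw : derivable (v - u) c 1 by exact: derivableB.
have w0 : 'D_1 (v - u) c = 0.
  apply: derive_at_local_min => //; apply: filterS uhv => x /andP[ux xv].
  by rewrite !fctE uc vc subrr subr_ge0 (le_trans ux).
have cw : `|t^-1 *: (((v - u) \o shift c) (t *: 1) - (v - u) c)| @[t --> 0^']
    --> (0 : R).
  rewrite -[X in _ --> X](normr0 R) -[X in `|X| : R]w0.
  by apply: cvg_norm; exact: dw.
suff dhu : derivable (h - u) c 1.
  by rewrite -[h](subrK u); exact: derivableD.
apply: (cvgP 0); apply/norm_cvg0P; apply: (squeeze_cvgr _ (cvg_cst 0) cw).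
move: uhv => /near_dnbhs0_shift; apply: filterS => t /andP[ux xv].
rewrite normr_ge0/= !fctE uc vc !subrr !subr0 !normrZ ler_wpM2l//=.
by rewrite !ger0_norm ?subr_ge0 ?lerB// (le_trans ux).
Qed.

Lemma sum_threshold (V : nmodType) (n k : nat) (x y : V) : (k <= n)%N ->
  \sum_(i < n) (if (i < k)%N then x else y) = x *+ k + y *+ (n - k).
Proof.
move=> kn.
rewrite -(big_mkord xpredT (fun i => if (i < k)%N then x else y)).
rewrite (big_cat_nat (leq0n k) kn) /=; congr (_ + _).
  rewrite -[in RHS](subn0 k) -sumr_const_nat; apply: eq_big_nat => i.
  by move=> /andP[_ ->].
rewrite -sumr_const_nat; apply: eq_big_nat => i /andP[ki _].
by rewrite ltnNge ki.
Qed.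

(** * Increasing generators and convexity *)

Section increasing_generators.
Variables (R : realType) (I : set R).
Hypothesis hI : is_interval I.

(** Decreasing generators are reduced to this case in [generator_inc]. *)
Definition inc_generator (f : R -> R) : Prop :=
  {within I, continuous f} /\ {in I &, {homo f : x y / x < y}}.

Lemma inc_generator_mono (f : R -> R) (x y : R) :
  inc_generator f -> I x -> I y -> (f x < f y) = (x < y).
Proof.
move=> [_ incf] Ix Iy.
exact: (leW_mono_in (le_mono_in incf) (mem_set Ix) (mem_set Iy)).
Qed.

Lemma inc_generator_inj (f : R -> R) (x y : R) :
  inc_generator f -> I x -> I y -> f x = f y -> x = y.
Proof.
move=> gf Ix Iy fxy.
have [xy|yx|//] := ltgtP x y.
- by move: xy; rewrite -(inc_generator_mono _ _ _ gf Ix Iy) fxy ltxx.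
- by move: yx; rewrite -(inc_generator_mono _ _ _ gf Iy Ix) fxy ltxx.
Qed.

Lemma inc_generator_IVT (f : R -> R) (a b v : R) :
  inc_generator f -> I a -> I b -> a <= b -> f a <= v <= f b ->
  exists c, [/\ a <= c <= b, I c & f c = v].
Proof.
move=> [cf _] Ia Ib ab /andP[av vb].
have abI : `[a, b] `<=` I by move=> x /=; rewrite in_itv /=; exact: hI.
have [|c] := IVT (v := v) ab (continuous_subspaceW abI cf).
  by rewrite ge_min av le_max vb orbT.
by move=> cab <-; exists c; split => //; apply: abI.
Qed.

Lemma qamean_eq (f : R -> R) (n : nat) (t : n.+1.-tuple I) (c : I) :
  inc_generator f ->
  f (val c) = (\sum_(i < n.+1) f (val (tnth t i))) / n.+1%:R ->
  qamean I f n t = c.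
Proof.
move=> gf fc; apply: xget_unique => //= y fy; apply: val_inj.
apply: (inc_generator_inj _ _ _ gf); [exact: set_valP|exact: set_valP|].
by rewrite fy fc.
Qed.

(** Compare the two means on the tuple made of [k] copies of [a] followed by copies of [b]: its
    [f]-mean is [c], and [h] maps its [h]-mean to the right-hand side. *)
Lemma mean_le_rational (f h : R -> R) (a b c : R) (n k : nat) :
  inc_generator f -> inc_generator h ->
  mean_le (qamean I f) (qamean I h) ->
  I a -> I b -> I c -> a <= b -> (k <= n.+1)%N ->
  let s := k%:R / n.+1%:R in
  f c = s * f a + (1 - s) * f b -> h c <= s * h a + (1 - s) * h b.
Proof.
move=> gf gh fh Ia Ib Ic ab kn s fc.
pose A : I := SigSub (mem_set Ia); pose B : I := SigSub (mem_set Ib).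
pose C : I := SigSub (mem_set Ic).
pose t : n.+1.-tuple I := [tuple if (i < k)%N then A else B | i < n.+1].
have meanE (g : R -> R) :
    (\sum_(i < n.+1) g (val (tnth t i))) / n.+1%:R = s * g a + (1 - s) * g b.
  under eq_bigr do rewrite tnth_mktuple fun_if /= (fun_if g).
  rewrite sum_threshold// -[g a *+ k]mulr_natr -[g b *+ _]mulr_natr natrB//.
  by rewrite /s; field; rewrite nat1r pnatr_eq0.
have /andP[s0 s1] : 0 <= s <= 1.
  by rewrite divr_ge0//= ler_pdivrMr// mul1r ler_nat.
have hab : h a <= h b.
  by rewrite leNgt (inc_generator_mono _ _ _ gh Ib Ia) -leNgt.
have [|d [_ Id hd]] := inc_generator_IVT h a b (s * h a + (1 - s) * h b) gh Ia Ib ab.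
  by apply/andP; split; nra.
have := fh n t.
rewrite (qamean_eq _ _ _ C gf) ?meanE//.
rewrite (qamean_eq _ _ _ (SigSub (mem_set Id)) gh) ?meanE//= => cd.
by rewrite -hd leNgt (inc_generator_mono _ _ _ gh Id Ic) -leNgt.
Qed.

Lemma mean_le_convex (f h : R -> R) (a b c s : R) :
  inc_generator f -> inc_generator h ->
  mean_le (qamean I f) (qamean I h) ->
  I a -> I b -> a < b -> I c -> 0 < s < 1 ->
  f c = s * f a + (1 - s) * f b -> h c <= s * h a + (1 - s) * h b.
Proof.
(* If h c exceeds the value s * h a + (1 - s) * h b =: h y, then a rational
   weight strictly between s and that of y gives a z with y < z < c at which
   the inequality for rational weights fails. *)
move=> gf gh fh Ia Ib ab Ic /andP[s0 s1] fc; rewrite leNgt; apply/negP => hc.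
have fab : f a < f b by rewrite (inc_generator_mono _ _ _ gf).
have hab : h a < h b by rewrite (inc_generator_mono _ _ _ gh).
have ac : a < c by rewrite -(inc_generator_mono _ _ _ gf Ia Ic) fc; nra.
have [|y [/andP[ay yc] Iy hy]] :=
    inc_generator_IVT h a c (s * h a + (1 - s) * h b) gh Ia Ic (ltW ac).
  by rewrite (ltW hc) andbT; nra.
have {}yc : f y < f c.
  by rewrite (inc_generator_mono _ _ _ gf)// -(inc_generator_mono _ _ _ gh)// hy.
have fay : f a <= f y.
  by rewrite leNgt (inc_generator_mono _ _ _ gf)// -leNgt.
have fba : 0 < f b - f a by rewrite subr_gt0.
pose s' := (f b - f y) / (f b - f a).
have fyE : f y = s' * f a + (1 - s') * f b.
  by rewrite /s'; field; rewrite gt_eqF.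
have s's : s < s' by nra.
have s'1 : s' <= 1 by rewrite ler_pdivrMr// mul1r lerB.
have [n [k [kn sk ks']]] : exists n k : nat,
    [/\ (k <= n.+1)%N, s < k%:R / n.+1%:R & k%:R / n.+1%:R < s' :> R].
  have d0 : 0 < s' - s by rewrite subr_gt0.
  have /truncn_itv/andP[_] : 0 <= (s' - s)^-1 by rewrite invr_ge0 ltW.
  (* With [n] the integer part of [1 / (s' - s)], the multiples of [1 / n.+1] are spaced by less
     than [s' - s]; the first one above [s] therefore stays below [s']. *)
  set n := Num.truncn _ => nN.
  have {}nN : 1 < (s' - s) * n.+1%:R by rewrite -ltr_pdivrMl// mulr1.
  have /andP[] := truncn_itv (mulr_ge0 (ltW s0) (ler0n R n.+1)).
  set k := Num.truncn _ => ks sk.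
  have ks' : k.+1%:R < s' * n.+1%:R by rewrite -natr1; lra.
  exists n, k.+1; split; last by rewrite ltr_pdivrMr.
  - rewrite -(ler_nat R) (le_trans (ltW ks'))//.
    by rewrite -[leRHS]mul1r ler_wpM2r.
  - by rewrite ltr_pdivlMr.
set r : R := k%:R / n.+1%:R in sk ks'.
have [|z [_ Iz fz]] :=
    inc_generator_IVT f a b (r * f a + (1 - r) * f b) gf Ia Ib (ltW ab).
  by apply/andP; split; nra.
(* Here [s < r] puts the bound for [h z] below [h y], while [r < s'] gives [f y < f z], hence
   [h y < h z]. *)
have := mean_le_rational f h a b z n k gf gh fh Ia Ib Iz (ltW ab) kn fz.
rewrite -/r leNgt => /negP; apply.
have : h y < h z.
  rewrite (inc_generator_mono _ _ _ gh)// -(inc_generator_mono _ _ _ gf)//.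
  by rewrite fz fyE; nra.
by apply: le_lt_trans; rewrite hy; nra.
Qed.

(** * Chord slopes and supporting lines *)

(** This is the convexity inequality at the weight [s] that expresses [f c] through [f a] and [f b],
    with denominators cleared. *)
Lemma mean_le_slopes (f h : R -> R) (a b c : R) :
  inc_generator f -> inc_generator h ->
  mean_le (qamean I f) (qamean I h) ->
  I a -> I b -> a < c < b ->
  (h c - h a) / (f c - f a) <= (h b - h c) / (f b - f c).
Proof.
move=> gf gh fh Ia Ib /andP[ac cb].
have Ic : I c by apply: (hI _ _ Ia Ib); rewrite !ltW.
have fac : f a < f c by rewrite (inc_generator_mono _ _ _ gf).
have fcb : f c < f b by rewrite (inc_generator_mono _ _ _ gf).
have fba : 0 < f b - f a by rewrite subr_gt0 (lt_trans fac).
pose s := (f b - f c) / (f b - f a).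
have sM : s * (f b - f a) = f b - f c by rewrite divfK// gt_eqF.
have s01 : 0 < s < 1.
  apply/andP; split; first by rewrite divr_gt0// subr_gt0.
  by rewrite ltr_pdivrMr// mul1r ltrD2l ltrN2.
have fcE : f c = s * f a + (1 - s) * f b by lra.
have hc := mean_le_convex f h a b c s gf gh fh Ia Ib (lt_trans ac cb) Ic s01 fcE.
rewrite ler_pdivrMr; last by nra.
rewrite mulrAC ler_pdivlMr; last by nra.
by nra.
Qed.

(** Take for [P] the supremum of the slopes of chords ending at [c] from the left; every slope to
    the right of [c] bounds it from above. *)
Lemma mean_le_support (f h : R -> R) (c : R) :
  inc_generator f -> inc_generator h ->
  mean_le (qamean I f) (qamean I h) -> I° c ->
  exists2 P, 0 < P & forall x, I x -> P * (f x - f c) <= h x - h c.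
Proof.
move=> gf gh fh Ic0.
have Ic : I c := interior_subset Ic0.
(* The point [a] makes the set of left slopes nonempty and the supremum positive; [b] makes the set
   bounded. *)
have [a [b [Ia Ib /andP[ac cb]]]] : exists a b, [/\ I a, I b & a < c < b].
  move: Ic0 => /nbhs_ballP[e /= e0 eI].
  exists (c - e / 2), (c + e / 2); split; last by apply/andP; split; lra.
  - by apply: eI; rewrite /ball/= ltr_norml; apply/andP; split; lra.
  - by apply: eI; rewrite /ball/= ltr_norml; apply/andP; split; lra.
pose slope x := (h c - h x) / (f c - f x).
pose E := [set slope x | x in [set x | I x /\ x < c]].
have slope_gt0 x : I x -> x < c -> 0 < slope x.
  move=> Ix xc; rewrite divr_gt0// subr_gt0.
    by rewrite (inc_generator_mono _ _ _ gh).
  by rewrite (inc_generator_mono _ _ _ gf).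
have Eub x : I x -> c < x -> ubound E ((h x - h c) / (f x - f c)).
  by move=> Ix cx _ [y [Iy yc] <-]; apply: mean_le_slopes => //; apply/andP.
have Ea : E (slope a) by exists a.
have supE : has_sup E.
  by split; [exists (slope a)|exists ((h b - h c) / (f b - f c)); apply: Eub].
exists (sup E).
  by apply: (lt_le_trans (slope_gt0 _ Ia ac)); exact: ub_le_sup supE.2 _ Ea.
move=> x Ix; have [xc|cx|->] := ltgtP x c; last by rewrite !subrr mulr0.
- have fxc : f x < f c by rewrite (inc_generator_mono _ _ _ gf).
  have : slope x <= sup E by apply: ub_le_sup supE.2 _ _; exists x.
  rewrite ler_pdivrMr ?subr_gt0//; nra.
- have fxc : f c < f x by rewrite (inc_generator_mono _ _ _ gf).
  have : sup E <= (h x - h c) / (f x - f c) by apply: ge_sup supE.1 _; exact: Eub.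
  by rewrite ler_pdivlMr ?subr_gt0.
Qed.

Lemma derivable_mean_between (f g h : R -> R) (c : R) :
  inc_generator f -> inc_generator g -> inc_generator h ->
  derivable f c 1 -> derivable g c 1 -> I° c ->
  mean_le (qamean I f) (qamean I h) -> mean_le (qamean I h) (qamean I g) ->
  derivable h c 1.
Proof.
move=> gf gg gh df dg Ic fh hg.
have [P P0 hP] := mean_le_support f h c gf gh fh Ic.
have [Q Q0 hQ] := mean_le_support h g c gh gg hg Ic.
(* Both support inequalities are solved for [h]; the second is divided by [Q], which uses its
   positivity. *)
pose u := cst (h c) + P *: (f - cst (f c)).
pose v := cst (h c) + Q^-1 *: (g - cst (g c)).
apply: (derivable_sandwich R u h v).
- by apply: derivableD => //; apply: derivableZ; apply: derivableB.
- by apply: derivableD => //; apply: derivableZ; apply: derivableB.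
- by rewrite /u /= !fctE subrr scaler0 addr0.
- by rewrite /v /= !fctE subrr scaler0 addr0.
apply: filterS Ic => x Ix; rewrite /u /v !fctE /=; apply/andP; split.
- by rewrite -lerBrDl; exact: hP.
- by rewrite -lerBlDl /GRing.scale/= ler_pdivlMl//; exact: hQ.
Qed.

(** For decreasing [f], take [- f]: negating both sides of the equation that defines the mean leaves
    its solution set unchanged, so the two [xget] agree. *)
Lemma generator_inc (f : R -> R) : generator I f ->
  exists f', [/\ inc_generator f', qamean I f' = qamean I f &
    forall c, derivable f c 1 -> derivable f' c 1].
Proof.
move=> [cf [incf|decf]]; first by exists f; split.
exists (- f); split.
- split; first by move=> x; apply: continuousN; exact: cf.
  by move=> x y Ix Iy xy; rewrite ltrN2; exact: decf.
- apply: functional_extensionality_dep => n; apply/funext => t; congr xget.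
  apply/seteqP; split => y /=.
    by rewrite sumrN mulNr; exact: oppr_inj.
  by rewrite sumrN mulNr => <-.
- by move=> c; exact: derivableN.
Qed.

End increasing_generators.

Theorem theorem8 (R : realType) (I : set R) (x0 : R)
    (hI : is_interval I) (hx0 : (interior I) x0) :
  interval_type
    [set qamean I f
      | f in [set f : R -> R | generator I f /\ derivable f x0 1]].
Proof.
split; first by move=> _ [f [gf _] <-]; exists f.
move=> F G H [f [gf df] <-] [g [gg dg] <-] [h gh <-] fh hg.
have [f' [gf' f'E /(_ _ df) df']] := generator_inc R I f gf.
have [g' [gg' g'E /(_ _ dg) dg']] := generator_inc R I g gg.
have [h' [gh' h'E _]] := generator_inc R I h gh.
rewrite -f'E -h'E in fh; rewrite -g'E -h'E in hg; rewrite -h'E.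
(* Membership concerns the mean alone, so the increasing [h'] can serve as its generator in place of
   [h]. *)
exists h' => //; split; first by split; [exact: gh'.1|left; exact: gh'.2].
exact: derivable_mean_between hI f' g' h' x0 gf' gg' gh' df' dg' hx0 fh hg.
Qed.
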